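(* Let $\Gamma$ be an unbounded set in $\mathbb{C}$ and let $\mathscr{F}$ be a hypercyclicity set. Then every separable infinite-dimensional Banach space supports an $\mathscr{F}_{\Gamma}$-hypercyclic operator (that is, for every such space $X$ there is an $\mathscr{F}_\Gamma$-hypercyclic bounded linear operator on $X$).
   Context: Banach spaces are complex. $\mathbb{N}_0=\{0,1,2,\dots\}$. A Furstenberg family is a family $\mathscr{F}$ of subsets of $\mathbb{N}_0$ with $\emptyset\notin\mathscr{F}\neq\emptyset$ that is hereditarily upward: if $E\subset F\subset\mathbb{N}_0$ and $E\in\mathscr{F}$, then $F\in\mathscr{F}$. A hypercyclicity set is a Furstenberg family $\mathscr{F}$ for which there exists a sequence $(A_k)_{k\geq1}$ of pairwise disjoint sets in $\mathscr{F}$ such that for any $j\in A_k$ and $j'\in A_{k'}$ with $j\neq j'$ we have $|j-j'|\geq\max\{k,k'\}$. A bounded linear operator $T$ on $X$ is $\mathscr{F}_\Gamma$-hypercyclic if there is $x\in X$ such that $\{n\in\mathbb{N}_0: T^n(\Gamma x)\cap U\neq\emptyset\}\in\mathscr{F}$ for every non-empty open set $U\subset X$, where $\Gamma x=\{\lambda x:\lambda\in\Gamma\}$. *)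

(* Defs.v *)
From HB Require Import structures.
From mathcomp Require Import all_boot all_order all_algebra.
From mathcomp Require Import all_classical all_reals all_analysis.
From mathcomp Require Export complex.
Import Order.TTheory GRing.Theory Num.Theory.
Import numFieldNormedType.Exports.

Set Implicit Arguments.
Unset Strict Implicit.
Unset Printing Implicit Defensive.

Local Open Scope classical_set_scope.
Local Open Scope ring_scope.

Definition furstenberg_family (F : set (set nat)) : Prop :=
  [/\ ~ F set0, F !=set0
    & forall E G : set nat, E `<=` G -> F E -> F G].

(* The sequence (A k) is indexed by k >= 1; the value A 0 is irrelevant. *)
Definition hypercyclicity_set (F : set (set nat)) : Prop :=
  furstenberg_family F /\
  exists A : nat -> set nat,
    [/\ forall k, (1 <= k)%N -> F (A k),
        trivIset [set k | (1 <= k)%N] A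
      & forall k k' j j' : nat, (1 <= k)%N -> (1 <= k')%N ->
          A k j -> A k' j' -> j <> j' ->
          (maxn k k' <= `|j%:Z - j'%:Z|)%N].

Definition separable_space (X : topologicalType) : Prop :=
  exists2 D : set X, countable D & dense D.

Definition finite_dimensional (K : nzRingType) (X : lmodType K) : Prop :=
  exists (n : nat) (v : 'I_n -> X),
    forall x : X, exists c : 'I_n -> K, x = \sum_(i < n) c i *: v i.

Definition bounded_operator (K : numDomainType) (X : normedModType K)
    (T : {linear X -> X}) : Prop :=
  exists M : K, forall x : X, `|T x| <= M * `|x|.

Definition F_Gamma_hypercyclic (K : numDomainType) (X : normedModType K)
    (F : set (set nat)) (Gamma : set K) (T : X -> X) : Prop :=
  exists x : X, forall U : set X, open U -> U !=set0 ->
    F [set n | (iter n T @` [set l *: x | l in Gamma]) `&` U !=set0].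

(* Main.v *)
Require Import Defs.
From HB Require Import structures.
From mathcomp Require Import all_boot all_order all_algebra.
From mathcomp Require Import all_classical all_reals all_analysis.
From mathcomp Require Import zify ring lra.
Import Order.TTheory GRing.Theory Num.Theory.
Import numFieldNormedType.Exports.

(** Because [Gamma] is unbounded, the orbit of a vector may be rescaled at each
    time by an arbitrarily large scalar, so even a contraction can serve as the
    operator.  It suffices to have a contraction [T] and vectors [y k], dense in
    the strong sense that every open set contains [y k] for arbitrarily large
    [k], such that [T ^ k] kills [y k] and each [y k] has preimages under all the
    powers of [T] ([hypercyclicity_criterion]).  If [z n] is such a preimage of
    [y k] under [T ^ n] for [n] in [A k], the vector is the sum of the
    [(lam n)^-1 z n], with [lam n] in [Gamma] growing so fast that, at time [n],
    the terms of later index are negligible; those of earlier index are killed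
    by [T ^ n] thanks to the separation of the sets [A k].

    Such a [T] exists on every separable infinite-dimensional Banach space
    ([operator_on_separable_space]).  Take an increasing sequence of
    [n]-dimensional subspaces [W n] spanned by [e 0, ..., e (n - 1)], with dense
    union, and bounded functionals [f n] that vanish on [W n] and not at [e n].
    A series of multiples of the rank-one maps [x |-> f (n + 1) x *: e n]
    converges to a contraction if the coefficients are small
    ([operator_of_functionals]).  It maps [W (n + 1)] into [W n], and onto it
    by triangularity, so it is nilpotent on each [W n] while every vector of
    the dense union has preimages of all orders.  The functionals come from the
    Hahn-Banach theorem ([hahn_banach], [separating_functional]) and from the
    closedness of finite-dimensional subspaces ([in_span_separated]), which is
    itself derived from separating functionals by induction on the dimension. *)

Set Implicit Arguments.
Unset Strict Implicit.
Unset Printing Implicit Defensive.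
Local Open Scope classical_set_scope.
Local Open Scope ring_scope.

(** * The Hahn-Banach theorem *)

(** Partially defined linear functionals are represented by their graphs, so
    that extension is inclusion and the upper bound of a chain is a union. *)
Definition linear_relation (R : realType) (V : lmodType R) (G : set (V * R)) :=
  forall a b t, G a -> G b -> G (a.1 + t *: b.1, a.2 + t * b.2).

Definition dominated (R : realType) (V : lmodType R) (p : V -> R)
  (G : set (V * R)) := forall a, G a -> a.2 <= p a.1.

Section HahnBanach.
Variables (R : realType) (V : lmodType R) (p : V -> R).
Hypothesis p_add : forall x y, p (x + y) <= p x + p y.
Hypothesis p_scale : forall t x, 0 <= t -> p (t *: x) = t * p x.

Let p0 : p 0 = 0. Proof. by rewrite -(scale0r 0) p_scale // mul0r. Qed.

Lemma linear_relation0 (G : set (V * R)) : linear_relation G -> G !=set0 -> G (0, 0).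
Proof.
move=> linG [a Ga]; have := linG a a (-1) Ga Ga.
by rewrite scaleN1r mulN1r !subrr.
Qed.

Lemma linear_relation_scale (G : set (V * R)) y r t :
  linear_relation G -> G (y, r) -> G (t *: y, t * r).
Proof.
move=> linG Gyr.
have G0 : G (0, 0) by apply: linear_relation0 => //; exists (y, r).
by have := linG _ _ t G0 Gyr; rewrite /= !add0r.
Qed.

(** The value at [z] can be any number between all the lower bounds
    [r - p (y - z)] and all the upper bounds [p (y + z) - r], for [(y, r)] in
    [G]; subadditivity of [p] puts the former below the latter.  Homogeneity
    then carries the inequality from [y - z] and [y + z] to [y + t z]. *)
Lemma dominated_one_step (G : set (V * R)) (z : V) :
    linear_relation G -> dominated p G -> G !=set0 ->
  exists a : R, forall y r t, G (y, r) -> r + t * a <= p (y + t *: z).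
Proof.
move=> linG domG [g0 Gg0].
pose S := [set c.2 - p (c.1 - z) | c in G].
have ubS y' r' : G (y', r') -> ubound S (p (y' + z) - r').
  move=> G' _ [[y r] Gyr <-] /=.
  have /= := domG _ (linG _ _ 1 Gyr G'); rewrite scale1r mul1r.
  have := p_add (y - z) (y' + z); rewrite addrACA addNr addr0; lra.
have supS : has_sup S.
  split; first by exists (g0.2 - p (g0.1 - z)); exists g0.
  by case: g0 Gg0 => y r Gg0; exists (p (y + z) - r); apply: ubS.
exists (sup S) => y r t Gyr.
have [t0|t0|->] := ltgtP t 0; last first.
- by rewrite mul0r scale0r !addr0; have := domG _ Gyr.
- have := ge_sup (proj1 supS) (ubS _ _ (linear_relation_scale t^-1 linG Gyr)).
  move=> /(ler_wpM2l (ltW t0)); rewrite mulrBr -(p_scale _ (ltW t0)) scalerDr.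
  by rewrite scalerA mulrA divff ?gt_eqF// scale1r mul1r lerBrDl.
- have s0 : 0 < - t by rewrite oppr_gt0.
  have /ub_le_sup : has_ubound S by case: supS.
  move=> /(_ _ (ex_intro2 _ _ _ (linear_relation_scale (- t)^-1 linG Gyr) erefl)).
  move=> /= /(ler_wpM2l (ltW s0)); rewrite mulrBr -(p_scale _ (ltW s0)) scalerBr.
  rewrite scalerA mulrA divff ?gt_eqF// scale1r mul1r scaleNr opprK; lra.
Qed.

(** A maximal dominated graph is defined everywhere by [dominated_one_step],
    and domination makes it single-valued: [(0, r)] and [(0, - r)] in the graph
    give [r <= p 0 = 0] and [- r <= 0]. *)
Theorem hahn_banach (G0 : set (V * R)) :
    linear_relation G0 -> dominated p G0 -> G0 !=set0 ->
  exists u : {scalar V},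
    (forall a, G0 a -> u a.1 = a.2) /\ forall x, u x <= p x.
Proof.
move=> linG0 domG0 neG0.
(* Uniting with [G0] makes the empty chain harmless: its union satisfies [P]. *)
pose P (A : set (V * R)) := linear_relation (A `|` G0) /\ dominated p (A `|` G0).
have [F FP totF|A [[linG domG] maxA]] := @Zorn_bigcup _ P.
  split=> [a b t|a].
  - move=> [[A FA Aa]|G0a] [[B FB Bb]|G0b].
    + have [AB|BA] := totF _ _ FA FB.
        have [lin _] := FP _ FB.
        by case: (lin a b t (or_introl (AB _ Aa)) (or_introl Bb)); [left; exists B|right].
      have [lin _] := FP _ FA.
      by case: (lin a b t (or_introl Aa) (or_introl (BA _ Bb))); [left; exists A|right].
    + have [lin _] := FP _ FA.
      by case: (lin a b t (or_introl Aa) (or_intror G0b)); [left; exists A|right].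
    + have [lin _] := FP _ FB.
      by case: (lin a b t (or_intror G0a) (or_introl Bb)); [left; exists B|right].
    + by right; apply: linG0.
  - move=> [[A FA Aa]|G0a]; last exact: domG0.
    by have [_] := FP _ FA; apply; left.
set G := A `|` G0 in linG domG.
have neG : G !=set0 by case: neG0 => g; exists g; right.
have G00 := linear_relation0 linG neG.
have total z : exists r, G (z, r).
  apply: contrapT => nz.
  have [a Ha] := dominated_one_step z linG domG neG.
  pose B := [set (c.1.1 + c.2 *: z, c.1.2 + c.2 * a) | c in [set c : (V * R) * R | G c.1]].
  have GB : G `<=` B.
    by move=> [y r] Gyr; exists ((y, r), 0) => //=; rewrite scale0r mul0r !addr0.
  have BG0 : B `|` G0 = B.
    by apply/setUidPl => g G0g; apply: GB; right.
  apply: (maxA B).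
    split=> [g Ag|BA]; first by apply: GB; left.
    apply: nz; exists a; left; apply: BA.
    by exists ((0, 0), 1) => //=; rewrite scale1r mul1r !add0r.
  rewrite /P BG0; split=> [_ _ t [[[y r] s] /= Gyr <-] [[[y' r'] s'] /= Gyr' <-] /=|].
    exists ((y + t *: y', r + t * r'), s + t * s') => /=; first exact: (linG _ _ t Gyr Gyr').
    rewrite !(scalerDr, scalerDl, mulrDl, mulrDr) scalerA mulrA !addrA.
    by rewrite [y + _ + _]addrAC [r + _ + _]addrAC.
  by move=> _ [[[y r] s] /= Gyr <-] /=; apply: Ha.
have uniq z r r' : G (z, r) -> G (z, r') -> r = r'.
  move=> Gr Gr'; have /= := domG _ (linG _ _ (-1) Gr Gr').
  have /= := domG _ (linG _ _ (-1) Gr' Gr).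
  rewrite scaleN1r subrr p0; lra.
pose u z := projT1 (cid (total z)).
have Gu z : G (z, u z) by rewrite /u; case: cid.
have lin_u : linear_for *%R u.
  move=> t x y; apply: (uniq (t *: x + y)); first exact: Gu.
  by have := linG _ _ t (Gu y) (Gu x); rewrite /= [y + _]addrC [u y + _]addrC.
pose U : {scalar V} := HB.pack u (GRing.isLinear.Build R V R *%R u lin_u).
exists U; split=> [[z r] G0zr|x]; last exact: domG (Gu x).
by apply: (uniq z); [exact: Gu|right].
Qed.

End HahnBanach.

(** * Real-valued norms and real restriction of scalars *)

Section RealNorm.
Variable R : realType.
Implicit Types V : normedZmodType R[i].

(** The norm of a complex normed space takes its values in the partially ordered
    field [R[i]]; its real part carries the same information and lives in a
    totally ordered field. *)
Definition rnorm V (x : V) : R := complex.Re `|x|.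

Lemma rnormE V (x : V) : (rnorm x)%:C%C = `|x|.
Proof. by rewrite /rnorm RRe_real ?normr_real. Qed.

Lemma rnorm_ge0 V (x : V) : 0 <= rnorm x.
Proof. by rewrite -ler0c rnormE. Qed.

Lemma rnorm0 V : rnorm (0 : V) = 0.
Proof. by apply: complexI; rewrite rnormE normr0. Qed.

Lemma rnorm_eq0 V (x : V) : (rnorm x == 0) = (x == 0).
Proof.
apply/eqP/eqP => [x0|->]; last exact: rnorm0.
by apply: normr0_eq0; rewrite -rnormE x0.
Qed.

Lemma rnormD V (x y : V) : rnorm (x + y) <= rnorm x + rnorm y.
Proof. by rewrite -lecR rmorphD /= !rnormE ler_normD. Qed.

Lemma rnormN V (x : V) : rnorm (- x) = rnorm x.
Proof. by rewrite /rnorm normrN. Qed.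

Lemma rnormB V (x y : V) : rnorm (x - y) = rnorm (y - x).
Proof. by rewrite /rnorm distrC. Qed.

Lemma rnorm_sum V (I : Type) (s : seq I) (P : pred I) (u : I -> V) :
  rnorm (\sum_(i <- s | P i) u i) <= \sum_(i <- s | P i) rnorm (u i).
Proof.
apply: (big_ind2 (fun x r => rnorm x <= r)) => // [|x r y q xr yq].
  by rewrite rnorm0.
exact: le_trans (rnormD _ _) (lerD xr yq).
Qed.

Lemma rnormM (a b : R[i]) : rnorm (a * b) = rnorm a * rnorm b.
Proof. by apply: complexI; rewrite rmorphM /= !rnormE normrM. Qed.

Lemma rnormV (a : R[i]) : rnorm a^-1 = (rnorm a)^-1.
Proof. by apply: complexI; rewrite fmorphV /= !rnormE normfV. Qed.

Lemma rnormZ (X : normedModType R[i]) (a : R[i]) (x : X) :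
  rnorm (a *: x) = rnorm a * rnorm x.
Proof. by apply: complexI; rewrite rmorphM /= !rnormE normrZ. Qed.

Lemma rnorm_real (t : R) : rnorm t%:C%C = `|t|.
Proof. by rewrite /rnorm normc_def /= expr0n addr0 sqrtr_sqr. Qed.

End RealNorm.

(** The same additive group, on which only the real scalars act. *)
Definition realified (R : realType) (X : lmodType R[i]) : Type := X.

Section Realified.
Variables (R : realType) (X : lmodType R[i]).

HB.instance Definition _ := GRing.Zmodule.copy (realified X) X.

Let scale (t : R) (x : realified X) : realified X := t%:C%C *: (x : X).

Let scaleA a b x : scale a (scale b x) = scale (a * b) x.
Proof. by rewrite /scale scalerA rmorphM. Qed.

Let scale1 : left_id 1 scale.
Proof. by move=> x; rewrite /scale rmorph1 scale1r. Qed.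

Let scaleDr : right_distributive scale +%R.
Proof. by move=> a x y; rewrite /scale scalerDr. Qed.

Let scaleDl x : {morph scale^~ x : a b / a + b}.
Proof. by move=> a b; rewrite /scale rmorphD scalerDl. Qed.

HB.instance Definition _ :=
  GRing.Zmodule_isLmodule.Build R (realified X) scaleA scale1 scaleDr scaleDl.

Lemma realified_scaleE (t : R) (x : realified X) : t *: x = t%:C%C *: (x : X).
Proof. by []. Qed.

End Realified.

Definition is_subspace (K : pzRingType) (X : lmodType K) (W : set X) :=
  W 0 /\ forall a u v, W u -> W v -> W (a *: u + v).

(** * Separation of a point from a subspace *)

Section Separation.
Variables (R : realType) (X : normedModType R[i]).

(** On the real space spanned by [W] and [x], the functional sending
    [v + t x] to [t d] is dominated by the norm because [x] has distance at
    least [d] from [W].  Its Hahn-Banach extension [u] is the real part of the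
    complex functional [u y - i u (i y)], which vanishes on [W] because [W] is
    stable under multiplication by [i]. *)
Lemma separating_functional (W : set X) (x : X) (d : R) :
    is_subspace W -> 0 < d -> (forall v, W v -> d <= rnorm (x - v)) ->
  exists f : {scalar X},
    [/\ forall v, W v -> f v = 0, f x != 0
      & forall y, rnorm (f y) <= 2 * rnorm y].
Proof.
move=> [W0 linW] d0 dx.
pose p (y : realified X) := rnorm (y : X).
have p_add y z : p (y + z) <= p y + p z by exact: rnormD.
have p_scale t y : 0 <= t -> p (t *: y) = t * p y.
  by move=> t0; rewrite /p realified_scaleE rnormZ rnorm_real ger0_norm.
pose G0 : set (realified X * R) :=
  [set (c.1 + c.2%:C%C *: x : X, c.2 * d) | c in [set c : X * R | W c.1]].
have [|||u [uG0 u_le]] := @hahn_banach _ _ p p_add p_scale G0.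
- move=> _ _ t [[v s] /= Wv <-] [[v' s'] /= Wv' <-].
  exists (t%:C%C *: v' + v, s + t * s') => /=; first exact: linW.
  rewrite mulrDl mulrA; congr (_, _).
  rewrite realified_scaleE !rmorphD rmorphM /= scalerDl scalerDr scalerA.
  by rewrite [_ *: v' + v]addrC !addrA [v + _ + _]addrAC.
- move=> _ [[v t] /= Wv <-] /=.
  have [->|t0] := eqVneq t 0; first by rewrite mul0r rnorm_ge0.
  have W1 : W (- t^-1%:C%C *: v).
    by have := linW (- t^-1%:C%C) v 0 Wv W0; rewrite addr0.
  have := dx _ W1; rewrite scaleNr opprK => le_d.
  apply: (@le_trans _ _ (`|t| * d)); first by rewrite ler_wpM2r ?ler_norm// ltW.
  apply: (le_trans (ler_wpM2l (normr_ge0 t) le_d)).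
  rewrite -rnorm_real -rnormZ scalerDr scalerA -rmorphM /= mulfV//.
  by rewrite scale1r addrC.
- by exists (0, 0); exists (0, 0) => //=; rewrite scale0r mul0r addr0.
have uW v : W v -> u v = 0.
  move=> Wv; have /= := uG0 (v, 0); apply.
  by exists (v, 0) => //=; rewrite scale0r mul0r addr0.
have ux : u x = d.
  have /= := uG0 (x, d); apply.
  by exists (0, 1) => //=; rewrite scale1r mul1r add0r.
have uD (y z : X) : u (y + z : X) = u y + u z by exact: (raddfD u).
have uN (y : X) : u (- y : X) = - u y by exact: (raddfN u).
have uZ (t : R) (y : X) : u (t%:C%C *: y : X) = t * u y by exact: (linearZ_LR u t y).
have u_abs (y : X) : `|u y| <= rnorm y.
  by rewrite ler_norml lerNl -uN -{1}(rnormN y); apply/andP; split; exact: u_le.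
have uC (a : R[i]) (y : X) :
    u (a *: y : X) = complex.Re a * u y + complex.Im a * u ('i%C *: y : X).
  by rewrite {1}[a]complexE scalerDl uD uZ ['i%C * _]mulrC -scalerA uZ.
pose f (y : X) : R[i] := (u y -i* u ('i%C *: y : X))%C.
have lin_f : linear_for *%R f.
  move=> a y z; rewrite /f scalerDr !uD scalerA (uC a) (uC ('i%C * a)) ['i%C * a]mulrC ReiNIm ImiRe.
  case: a => a b /=; simpc; congr (_ +i* _)%C; ring.
pose F : {scalar X} := HB.pack f (GRing.isLinear.Build R[i] X R[i] *%R f lin_f).
exists F; split=> [v Wv||y].
- rewrite /F /= /f uW// uW ?oppr0//.
  by have := linW 'i%C v 0 Wv W0; rewrite addr0.
- by apply/eqP => /(congr1 (@complex.Re R)) /=; rewrite ux; apply/eqP; rewrite gt_eqF.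
have -> : F y = (u y)%:C%C - 'i%C * (u ('i%C *: y : X))%:C%C.
  by rewrite /F /= /f; simpc.
apply: (le_trans (rnormD _ _)); rewrite rnormN rnormM !rnorm_real.
have rnorm_i : rnorm ('i%C : R[i]) = 1.
  by rewrite /rnorm normc_def /= expr0n add0r expr1n sqrtr1.
have := u_abs y; have := u_abs ('i%C *: y); rewrite rnormZ rnorm_i; lra.
Qed.

End Separation.

(** * Convergence, openness and unboundedness in terms of the real norm *)

Section Topology.
Variable R : realType.

Lemma posC_real (e : R[i]) : 0 < e -> exists2 r : R, 0 < r & e = r%:C%C.
Proof.
move=> e0; exists (complex.Re e); last by rewrite RRe_real// gtr0_real.
by rewrite -ltcR RRe_real// gtr0_real.
Qed.

Lemma open_rnorm (X : normedModType R[i]) (U : set X) (x : X) :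
  open U -> U x -> exists2 r : R, 0 < r & forall y, rnorm (y - x) < r -> U y.
Proof.
move=> oU Ux; have := open_nbhs_nbhs (conj oU Ux).
rewrite -nbhs_ballE => -[e /= /posC_real[r r0 ->]] xU; exists r => // y yx.
by apply: xU; rewrite -ball_normE /ball_ /= -rnormE ltcR rnormB.
Qed.

Lemma rnorm_open_ball (X : normedModType R[i]) (x : X) (r : R) :
  0 < r -> exists U : set X, [/\ open U, U x & forall y, U y -> rnorm (y - x) < r].
Proof.
move=> r0; exists (ball x r%:C%C)^°; split; first exact: open_interior.
  by apply: nbhsx_ballx; rewrite ltcR.
move=> y /interior_subset; rewrite -ball_normE /ball_ /= -rnormE ltcR.
by rewrite rnormB.
Qed.

Lemma unbounded_rnorm (G : set R[i]) :
  ~ bounded_set (G : set R[i]^o) -> forall M : R, exists2 l, G l & M <= rnorm l.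
Proof.
move=> nb M; apply: contrapT => noM; apply: nb.
exists M%:C%C; split; first by apply/complex_realP; exists M.
move=> K MK l /= Gl.
apply: (@le_trans _ _ M%:C%C); last exact: ltW.
have -> : `|l : R[i]^o| = (rnorm (l : R[i]))%:C%C by rewrite rnormE.
rewrite lecR leNgt; apply/negP => Ml.
by apply: noM; exists l => //; apply: ltW.
Qed.

Lemma geometric_tail (n m : nat) :
  \sum_(n <= i < m) (2^-1 : R) ^+ i <= 2 * 2^-1 ^+ n.
Proof.
have h0 k : 0 <= (2^-1 : R) ^+ k by rewrite exprn_ge0// invr_ge0.
have [nm|mn] := leqP n m; last by rewrite big_geq ?mulr_ge0// ltnW.
suff -> : \sum_(n <= i < m) (2^-1 : R) ^+ i = 2 * 2^-1 ^+ n - 2 * 2^-1 ^+ m.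
  by rewrite gerBl mulr_ge0.
elim: m nm => [|m IH]; first by rewrite leqn0 => /eqP->; rewrite big_geq// subrr.
rewrite leq_eqVlt => /orP[/eqP<-|]; first by rewrite big_geq// subrr.
by rewrite ltnS => nm; rewrite big_nat_recr//= IH// exprS; field.
Qed.

Lemma half_pow_small (c e : R) :
  0 < e -> exists N, forall n, (N <= n)%N -> c * 2^-1 ^+ n < e.
Proof.
move=> e0; exists (Num.truncn (`|c| / e)).+1 => n Nn.
have h0 k : 0 < (2^-1 : R) ^+ k by rewrite exprn_gt0// invr_gt0.
apply: (@le_lt_trans _ _ (`|c| * 2^-1 ^+ n)).
  by rewrite ler_wpM2r ?ler_norm// ltW.
rewrite exprVn ltr_pdivrMr ?exprn_gt0// mulrC -ltr_pdivrMr//.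
apply: (lt_le_trans (truncnS_gt _)); rewrite -natrX ler_nat.
by apply: leq_trans Nn _; apply: ltnW; apply: ltn_expl.
Qed.

Lemma le_half_pow (a b c : R) (N : nat) :
  (forall n, (N <= n)%N -> a <= b + c * 2^-1 ^+ n) -> a <= b.
Proof.
move=> H; rewrite leNgt; apply/negP => ba.
have [|M HM] := @half_pow_small c (a - b); first by rewrite subr_gt0.
have := H _ (leq_maxl N M); have := HM _ (leq_maxr N M); lra.
Qed.

Lemma geometric_series (X : completeNormedModType R[i]) (u : nat -> X) (C : R) :
    (forall n, rnorm (u n) <= C * 2^-1 ^+ n) ->
  exists l, forall n, rnorm (l - \sum_(0 <= i < n) u i) <= 2 * C * 2^-1 ^+ n.
Proof.
move=> uC; pose s n := \sum_(0 <= i < n) u i.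
have C0 : 0 <= C by have := uC 0%N; rewrite expr0 mulr1; apply/le_trans/rnorm_ge0.
have s_tail n m : (n <= m)%N -> rnorm (s m - s n) <= 2 * C * 2^-1 ^+ n.
  move=> nm; rewrite /s (big_cat_nat (leq0n n) nm)/= addrAC subrr add0r.
  apply: (le_trans (rnorm_sum _ _ _)).
  apply: (le_trans (ler_sum _ (fun i _ => uC i))).
  by rewrite -mulr_sumr [2 * C]mulrC -mulrA ler_wpM2l// geometric_tail.
have : cvg (s @ \oo).
  apply: cauchy_cvg; apply: cauchy_exP => _ /posC_real[r r0 ->].
  have [N HN] := half_pow_small (2 * C) r0.
  exists (s N); exists N => // n /= Nn.
  rewrite -ball_normE /ball_ /= -rnormE ltcR rnormB.
  exact: le_lt_trans (s_tail _ _ Nn) (HN _ (leqnn N)).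
move=> /cvg_ex[l /cvgrPdist_lt sl]; exists l => n.
apply/ler_addgt0Pr => e e0.
have [|M _ HM] := sl e%:C%C; first by rewrite ltcR.
have := HM _ (leq_maxl M n); rewrite /= -rnormE ltcR => l1.
have := s_tail n _ (leq_maxr M n) => l2.
rewrite -[l - _](subrKA (s (maxn M n))).
by apply: (le_trans (rnormD _ _)); rewrite addrC lerD// ltW.
Qed.

End Topology.

(** * Operators defined by series of rank-one maps *)

Section Operator.
Variables (R : realType) (X : completeNormedModType R[i]).

Lemma rnorm_half_pow0 (x : X) (c : R) (N : nat) :
  (forall n, (N <= n)%N -> rnorm x <= c * 2^-1 ^+ n) -> x = 0.
Proof.
move=> H; apply/eqP; rewrite -rnorm_eq0 eq_le rnorm_ge0 andbT.
by apply: (@le_half_pow _ _ _ c N) => n Nn; rewrite add0r; apply: H.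
Qed.

(** The coefficients [c i] are small enough for the series of the rank-one
    operators [x |-> c i * g i x *: e i] to converge in norm to a contraction.
    They are nonzero, so that the finite sums that give [T] on suitable vectors
    keep the triangular structure of [e] and [g]. *)
Lemma operator_of_functionals (e : nat -> X) (g : nat -> {scalar X}) :
    (forall n y, rnorm (g n y) <= 2 * rnorm y) ->
  exists (c : nat -> R[i]) (T : {linear X -> X}),
    [/\ forall i, c i != 0, forall x, rnorm (T x) <= rnorm x
      & forall x N, (forall i, (N <= i)%N -> g i x = 0) ->
          T x = \sum_(0 <= i < N) (c i * g i x) *: e i].
Proof.
move=> g_le.
(* With the bound 2 on the norm of [g i], the [i]-th rank-one map has norm at
   most [2 ^- i / 2], and these norms add up to at most 1. *)
pose w i : R := 2^-1 ^+ i / (4 * (1 + rnorm (e i))).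
have E0 i : 0 < 4 * (1 + rnorm (e i)).
  by rewrite mulr_gt0// ltr_pwDl// rnorm_ge0.
have w0 i : 0 < w i by rewrite divr_gt0// exprn_gt0// invr_gt0.
pose c i : R[i] := (w i)%:C%C.
pose S x n := \sum_(0 <= i < n) (c i * g i x) *: e i.
have term_le x i : rnorm ((c i * g i x) *: e i) <= rnorm x / 2 * 2^-1 ^+ i.
  rewrite rnormZ rnormM /c rnorm_real gtr0_norm//.
  apply: (@le_trans _ _ (w i * (2 * rnorm x) * (1 + rnorm (e i)))).
    apply: ler_pM; [|exact: rnorm_ge0| |by rewrite lerDr].
      by apply: mulr_ge0; [exact: ltW|exact: rnorm_ge0].
    by apply: ler_wpM2l; [exact: ltW|exact: g_le].
  suff -> : w i * (2 * rnorm x) * (1 + rnorm (e i)) = rnorm x / 2 * 2^-1 ^+ i by [].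
  have := E0 i; rewrite pmulr_rgt0// => /lt0r_neq0 e1.
  by rewrite /w; field.
pose t x := projT1 (cid (geometric_series (term_le x))).
have tS x n : rnorm (t x - S x n) <= rnorm x * 2^-1 ^+ n.
  rewrite /t; case: cid => l /= /(_ n) /le_trans; apply.
  by rewrite [2 * _]mulrC divfK// pnatr_eq0.
have lin_t : linear t.
  move=> a x y; apply/eqP; rewrite -subr_eq0; apply/eqP.
  apply: (@rnorm_half_pow0 _ (rnorm (a *: x + y) + rnorm a * rnorm x + rnorm y) 0) => n _.
  have SD : S (a *: x + y) n = a *: S x n + S y n.
    rewrite /S scaler_sumr -big_split/=; apply: eq_bigr => i _.
    by rewrite scalerA -scalerDl linearP mulrDr mulrCA.
  have -> : t (a *: x + y) - (a *: t x + t y) =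
      (t (a *: x + y) - S (a *: x + y) n) + a *: (S x n - t x) + (S y n - t y).
    by rewrite SD scalerBr -addrA (addrACA (a *: S x n)) -opprD subrKA.
  apply: (le_trans (rnormD _ _)); rewrite mulrDl lerD//; last by rewrite rnormB.
  apply: (le_trans (rnormD _ _)); rewrite mulrDl lerD// rnormZ -mulrA.
  by rewrite ler_wpM2l ?rnorm_ge0// rnormB.
pose T : {linear X -> X} := HB.pack t (GRing.isLinear.Build R[i] X X *:%R t lin_t).
exists c, T; split=> [i|x|x N gN].
- by rewrite /c -rnorm_eq0 rnorm_real normr_eq0 gt_eqF.
- by have := tS x 0%N; rewrite /S big_geq// subr0 expr0 mulr1.
- apply/eqP; rewrite -subr_eq0; apply/eqP.
  apply: (@rnorm_half_pow0 _ (rnorm x) N) => n Nn.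
  suff SN : S x n = S x N by move: (tS x n); rewrite SN.
  rewrite /S (big_cat_nat (leq0n N) Nn)/= [X in _ + X]big1_seq ?addr0//.
  move=> i /andP[_]; rewrite mem_index_iota => /andP[Ni _].
  by rewrite gN// mulr0 scale0r.
Qed.

End Operator.

(** * A hypercyclicity criterion *)

Lemma iter_linear (K : pzRingType) (X : lmodType K) (T : {linear X -> X}) (n : nat) :
  linear (iter n T).
Proof. by elim: n => // n IH a x y /=; rewrite IH linearP. Qed.

Section Criterion.
Variable R : realType.

(** A scalar is picked after all the previous ones, so it may be required to
    dominate any multiple of them.  The recursion carries the sum [s n] of the
    moduli already picked. *)
Lemma fast_growing_scalars (G : set R[i]) (b : nat -> R) :
    (forall M : R, exists2 l, G l & M <= rnorm l) -> (forall n, 0 <= b n) ->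
  exists lam : nat -> R[i], forall n,
    [/\ G (lam n), 0 < rnorm (lam n), b n <= rnorm (lam n)
      & forall m, (m < n)%N -> b n * rnorm (lam m) <= rnorm (lam n)].
Proof.
move=> unbG b0.
have /choice[pick pickP] : forall M, exists l, G l /\ M <= rnorm l.
  by move=> M; have [l] := unbG M; exists l.
pose next n t := pick (1 + b n * (1 + t)).
pose s := fix s n := if n is m.+1 then s m + rnorm (next m (s m)) else 0 : R.
pose lam n := next n (s n).
have s0 n : 0 <= s n by elim: n => //= n IH; rewrite addr_ge0 ?rnorm_ge0.
have lam_le m n : (m < n)%N -> rnorm (lam m) <= s n.
  elim: n => // n IH; rewrite ltnS leq_eqVlt => /orP[/eqP->|/IH] /=.
    by rewrite lerDr.
  by move=> /le_trans; apply; rewrite lerDl rnorm_ge0.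
exists lam => n; have [Gn big_n] := pickP (1 + b n * (1 + s n)).
have bs : 0 <= b n * s n by rewrite mulr_ge0.
have := b0 n; split=> //.
- apply: lt_le_trans big_n; rewrite mulrDr; lra.
- apply: le_trans big_n; rewrite mulrDr; lra.
- move=> m /lam_le /(ler_wpM2l (b0 n)) /le_trans; apply.
  apply: le_trans big_n; rewrite mulrDr; lra.
Qed.

Variable X : completeNormedModType R[i].

Lemma contraction_iter (T : X -> X) (n : nat) (x : X) :
  (forall y, rnorm (T y) <= rnorm y) -> rnorm (iter n T x) <= rnorm x.
Proof. by move=> T1; elim: n => //= n; apply: le_trans. Qed.

(** The vector is the sum of [(lam n)^-1 z n] over the [n] in the sets [A k],
    with [z n] a preimage of [y k] under [T ^ n].  At a time [n] in [A k], the
    [n]-th term of [lam n T ^ n x] is [y k].  An earlier term, indexed by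
    [i] in [A k'], vanishes: [n - i >= k'], so [T ^ (n - i)] kills [y k'].  A
    later term has index at least [n + k], and [lam i] was chosen large enough
    compared with [lam n] to make it at most [2 ^- i]; together the later terms
    have norm at most [2 * 2 ^- k].  So the error depends on [k] only, and a
    whole set [A k] of times works for a given open set, as soon as [k] is
    large and [y k] lies well inside the open set. *)
Theorem hypercyclicity_criterion (F : set (set nat)) (Gamma : set R[i])
    (T : {linear X -> X}) (y : nat -> X) :
    hypercyclicity_set F ->
    (forall M : R, exists2 l, Gamma l & M <= rnorm l) ->
    (forall x, rnorm (T x) <= rnorm x) ->
    (forall k, iter k T (y k) = 0) ->
    (forall k n, exists z, iter n T z = y k) ->
    (forall U : set X, open U -> U !=set0 ->
      forall N, exists2 k, (N <= k)%N & U (y k)) ->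
  F_Gamma_hypercyclic F Gamma T.
Proof.
move=> [[_ _ upF] [A [FA disA sepA]]] unbG T1 Tker Tlift ydense.
have /choice[z zP] : forall n, exists w : X,
    (forall k, (1 <= k)%N -> A k n -> iter n T w = y k) /\
    (w != 0 -> exists2 k, (1 <= k)%N & A k n).
  move=> n; have [[k k1 Akn]|nA] := pselect (exists2 k, (1 <= k)%N & A k n).
    have [w Tw] := Tlift k n; exists w; split=> [k' k'1 Ak'n|_]; last by exists k.
    by rewrite Tw; congr y; apply: disA => //; exists n.
  by exists 0; split=> [k k1 Akn|]; [case: nA; exists k|rewrite eqxx].
have z0_far n i k : (1 <= k)%N -> A k n -> i != n -> z i != 0 ->
    exists k', [/\ (1 <= k')%N, A k' i & (maxn k k' <= `|n%:Z - i%:Z|)%N].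
  move=> k1 Akn /eqP ni zi; have [k' k'1 Ak'i] := (zP i).2 zi.
  by exists k'; split=> //; apply: sepA => // /esym.
have [|lam lamP] := @fast_growing_scalars Gamma (fun n => 2 ^+ n * rnorm (z n)) unbG.
  by move=> n; rewrite mulr_ge0 ?rnorm_ge0// exprn_ge0.
pose u n := (lam n)^-1 *: z n.
have [Tn TnE] : exists Tn : nat -> {linear X -> X}, forall n x, Tn n x = iter n T x.
  pose Tn n : {linear X -> X} := HB.pack (iter n T)
    (GRing.isLinear.Build R[i] X X *:%R (iter n T) (iter_linear T n)).
  by exists Tn.
have Tn1 n x : rnorm (Tn n x) <= rnorm x by rewrite TnE; exact: contraction_iter.
have lam0 n : lam n != 0 by rewrite -rnorm_eq0 gt_eqF//; case: (lamP n).
(* [c = 1] bounds the terms of the series; [c] the modulus of an earlier scalar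
   bounds the later terms along the orbit. *)
have u_le n (c : R) : 0 <= c -> 2 ^+ n * rnorm (z n) * c <= rnorm (lam n) ->
    c * rnorm (u n) <= 2^-1 ^+ n.
  move=> c0; have [_ l0 _ _] := lamP n.
  rewrite /u rnormZ rnormV mulrCA ler_pdivrMl// exprVn.
  rewrite ler_pdivlMr ?exprn_gt0// => /(le_trans _); apply.
  by rewrite mulrC [c * _]mulrC mulrA.
have u_small n : rnorm (u n) <= 1 * 2^-1 ^+ n.
  by rewrite mul1r -[rnorm _]mul1r u_le// mulr1; case: (lamP n).
have u_later m n : (m < n)%N -> rnorm (lam m *: Tn m (u n)) <= 2^-1 ^+ n.
  move=> mn; rewrite rnormZ; apply: (@le_trans _ _ (rnorm (lam m) * rnorm (u n))).
    by rewrite ler_wpM2l ?rnorm_ge0.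
  by rewrite u_le ?rnorm_ge0//; case: (lamP n) => _ _ _; apply.
have u_before n i k : (1 <= k)%N -> A k n -> (i < n)%N -> Tn n (u i) = 0.
  move=> k1 Akn i_n; rewrite /u linearZZ.
  have [->|zi] := eqVneq (z i) 0; first by rewrite linear0 scaler0.
  have [|k' [k'1 Ak'i far]] := z0_far n i k k1 Akn _ zi; first by rewrite ltn_eqF.
  have -> : n = ((n - i - k') + k' + i)%N by lia.
  by rewrite TnE !iterD ((zP i).1 k')// Tker -TnE linear0 scaler0.
(* The sets [A k] have no element strictly between [n] and [n + k]. *)
have u_gap n i k : (1 <= k)%N -> A k n -> (n < i < n + k)%N -> u i = 0.
  move=> k1 Akn ni; rewrite /u.
  have [->|zi] := eqVneq (z i) 0; first by rewrite scaler0.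
  have [|k' [k'1 Ak'i far]] := z0_far n i k k1 Akn _ zi; first by lia.
  by lia.
have [x xP] := geometric_series u_small.
have orbit_near n k : (1 <= k)%N -> A k n ->
    rnorm (iter n T (lam n *: x) - y k) <= 2 * 2^-1 ^+ k.
  move=> k1 Akn; rewrite -TnE.
  pose S M := \sum_(0 <= i < M) u i.
  apply: (@le_half_pow _ _ _ (rnorm (lam n) * 2) (n + k)) => M nkM.
  have -> : Tn n (lam n *: x) - y k =
      lam n *: Tn n (x - S M) + (lam n *: Tn n (S M) - y k).
    by rewrite linearZZ linearB scalerBr subrKA.
  apply: (le_trans (rnormD _ _)); rewrite addrC; apply: lerD; last first.
    rewrite rnormZ -mulrA ler_wpM2l ?rnorm_ge0//.
    by apply: le_trans (Tn1 _ _) _; have := xP M; rewrite mulr1.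
  have n_lt : (n < n + k)%N by lia.
  have -> : lam n *: Tn n (S M) - y k =
      \sum_(n + k <= i < M) lam n *: Tn n (u i).
    rewrite /S (big_cat_nat (leq0n (n + k)) nkM)/=.
    rewrite (big_cat_nat (leq0n n) (ltnW n_lt))/= (big_ltn n_lt).
    rewrite [X in _ + (_ + X)]big1_seq ?addr0; last first.
      by move=> i /andP[_]; rewrite mem_index_iota; apply: u_gap.
    rewrite !linearD/= !linear_sum/=.
    rewrite [X in X + _ + _]big1_seq ?add0r; last first.
      move=> i /andP[_]; rewrite mem_index_iota => /andP[_ i_n].
      by rewrite (u_before n i k k1 Akn i_n) scaler0.
    rewrite {1}/u linearZZ scalerA mulfV// scale1r.
    by rewrite TnE ((zP n).1 k)// addrAC subrr add0r.
  apply: (le_trans (rnorm_sum _ _ _)).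
  apply: (@le_trans _ _ (\sum_(n + k <= i < M) 2^-1 ^+ i)).
    rewrite big_nat [leRHS]big_nat; apply: ler_sum => i /andP[nki _].
    by apply: u_later; lia.
  apply: (le_trans (geometric_tail _ _ _)).
  rewrite ler_wpM2l// exprD ler_piMl// ?exprn_ge0 ?invr_ge0//.
  by rewrite exprn_ile1 ?invr_ge0// invf_le1// ler1n.
exists x => U oU [p Up].
have [r r0 rU] := open_rnorm oU Up.
have [N HN] := @half_pow_small R 2 (r / 2) (divr_gt0 r0 (ltr0Sn _ 1)).
have [B [oB Bp Br]] := rnorm_open_ball p (divr_gt0 r0 (ltr0Sn _ 1)).
have [|k Nk Bk] := ydense B oB _ N.+1; first by exists p.
have k1 : (1 <= k)%N by apply: leq_trans Nk.
apply: upF (FA k k1) => n Akn /=.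
exists (iter n T (lam n *: x)); split.
  by exists (lam n *: x) => //; exists (lam n) => //; case: (lamP n).
apply: rU; rewrite -(subrKA (y k)).
apply: (le_lt_trans (rnormD _ _)).
have := orbit_near n k k1 Akn; have := Br _ Bk; have := HN k (ltnW Nk); lra.
Qed.

End Criterion.

(** * Finite-dimensional subspaces *)

Fixpoint in_span (K : pzRingType) (X : lmodType K) (s : seq X) (x : X) : Prop :=
  if s is a :: s' then exists c : K, in_span s' (x - c *: a) else x = 0.

Section Span.
Variables (K : nzRingType) (X : lmodType K).
Implicit Types (s : seq X) (a x : X).

Lemma in_span_subspace s : is_subspace (in_span s).
Proof.
elim: s => [|a s [s0 s_lin]] /=.
  by split=> // c _ _ -> ->; rewrite scaler0 addr0.
split=> [|c u v [b bu] [b' b'v]]; first by exists 0; rewrite scale0r subr0.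
exists (c * b + b'); have := s_lin c _ _ bu b'v.
by rewrite scalerBr scalerA addrACA -opprD -scalerDl.
Qed.

Lemma in_span_cons s a x : in_span s x -> in_span (a :: s) x.
Proof. by exists 0; rewrite scale0r subr0. Qed.

Lemma in_span_head s a : in_span (a :: s) a.
Proof. by exists 1; rewrite scale1r subrr; case: (in_span_subspace s). Qed.

Lemma in_span_combination s x :
  in_span s x -> exists c : nat -> K, x = \sum_(i < size s) c i *: s`_i.
Proof.
elim: s x => [x ->|a s IH x [b /IH[c xE]]] /=.
  by exists (fun=> 0); rewrite big_ord0.
exists (fun n => if n is m.+1 then c m else b).
by rewrite big_ord_recl/= -xE addrC subrK.
Qed.

(** One new direction is always available, and it can be taken so that the
    enlarged span contains a prescribed vector: that vector itself if it is
    new, and any vector outside the span otherwise. *)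
Lemma infinite_dimensional_extend s x :
    ~ finite_dimensional X ->
  exists a, ~ in_span s a /\ in_span (a :: s) x.
Proof.
move=> infX; have [sx|] := pselect (in_span s x); last first.
  by exists x; split=> //; apply: in_span_head.
have [a sa] : exists a, ~ in_span s a.
  apply: contrapT => nex; apply: infX.
  exists (size s), (fun i => s`_i) => z.
  have [c zE] : exists c : nat -> K, z = \sum_(i < size s) c i *: s`_i.
    by apply: in_span_combination; apply: contrapT => sz; apply: nex; exists z.
  by exists (fun i => c i).
by exists a; split=> //; apply: in_span_cons.
Qed.

End Span.

Section Flag.
Variable R : realType.

(** Finite-dimensional subspaces are closed, stated as a positive distance.  A
    new direction [a] is separated from the old span by a functional [f], which
    reads off the coefficient of [a].  For [v] in the new span with coefficient
    [c], and [b = f x / f a], either [c] is far from [b] and [f] keeps [v] away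
    from [x], or [c] is close to [b] and the distance from [x - b a] to the old
    span does; the constant [C] weighs the two cases. *)
Lemma in_span_separated (X : normedModType R[i]) (s : seq X) (x : X) :
    ~ in_span s x ->
  exists2 d : R, 0 < d & forall v, in_span s v -> d <= rnorm (x - v).
Proof.
elim: s x => [|a s IH] x /= nsx.
  exists (rnorm x) => [|v ->]; last by rewrite subr0.
  by rewrite lt_neqAle rnorm_ge0 andbT eq_sym rnorm_eq0; apply/eqP.
have [s0 s_lin] := in_span_subspace s.
have [sa|/IH[da da0 da_le]] := pselect (in_span s a).
  have [|d d0 d_le] := IH x.
    by move=> sx; apply: nsx; exists 0; rewrite scale0r subr0.
  exists d => // v [c vc]; apply: d_le.
  by rewrite -(subrKC (c *: a) v); apply: s_lin.
have [f [fs fa f_le]] := separating_functional (in_span_subspace s) da0 da_le.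
pose b := f x / f a.
have [|d d0 d_le] := IH (x - b *: a); first by move=> ?; apply: nsx; exists b.
have fa0 : 0 < rnorm (f a).
  by rewrite lt_neqAle rnorm_ge0 andbT eq_sym rnorm_eq0.
pose C := 1 + 2 * rnorm a / rnorm (f a).
have C0 : 0 < C.
  by rewrite ltr_pwDl// divr_ge0 ?mulr_ge0 ?rnorm_ge0.
exists (d / C) => [|v [c vc]]; first exact: divr_gt0.
rewrite ler_pdivrMr//.
have fv : f v = c * f a.
  by apply/eqP; rewrite -subr_eq0 -linearZ -linearB; apply/eqP/fs.
have fxv : rnorm (b - c) * rnorm (f a) <= 2 * rnorm (x - v).
  apply: le_trans (f_le _); rewrite -rnormM linearB/= fv mulrBl.
  by rewrite /b divfK.
have := d_le _ vc.
have -> : x - b *: a - (v - c *: a) = (x - v) - (b - c) *: a.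
  by rewrite scalerBl !opprB addrACA [RHS]addrACA [- v - _]addrC.
move=> /le_trans -/(_ _ (rnormD _ _)); rewrite rnormN rnormZ => le_d.
apply: (le_trans le_d).
rewrite /C mulrDr mulr1 lerD2l mulrA ler_pdivlMr//.
have := ler_wpM2r (rnorm_ge0 a) fxv; lra.
Qed.

(** * The operator on a separable infinite-dimensional space *)

Lemma separable_dense_sequence (X : normedModType R[i]) :
    separable_space X ->
  exists d : nat -> X, forall U : set X, open U -> U !=set0 -> exists n, U (d n).
Proof.
move=> [D /countable_injP[f f_inj] denseD].
have /choice[d dP] : forall n, exists x, forall y, D y -> f y = n -> y = x.
  move=> n; have [[x Dx fx]|nD] := pselect (exists2 x, D x & f x = n).
    by exists x => y Dy fy; apply: f_inj; rewrite ?inE// fy.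
  by exists 0 => y Dy fy; case: nD; exists y.
exists d => U oU neU; have [x [Ux Dx]] := denseD U neU oU.
by exists (f x); rewrite -(dP _ x).
Qed.

Lemma recurrent_enumeration (j N : nat) :
  exists2 k, (N <= k)%N & logn 2 k = j.
Proof.
exists (2 ^ j * 3 ^ N)%N.
  by rewrite (leq_trans (ltnW (ltn_expl N (isT : 1 < 3)%N)))// leq_pmull// expn_gt0.
by rewrite lognM ?expn_gt0// pfactorK// lognX muln0 addn0.
Qed.

(** The subspace [W n] is spanned by [e 0, ..., e (n - 1)] and contains
    [d 0, ..., d (n - 1)] for a dense sequence [d].  The functional [f n]
    vanishes on [W n] but not at [e n].  For the operator built from the
    rank-one maps [x |-> f (n + 1) x *: e n], the triangular shape of the values
    [f i (e j)] makes [T] map [W (n + 1)] onto [W n], and [W 0] to 0. *)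
Theorem operator_on_separable_space (X : completeNormedModType R[i]) :
    separable_space X -> ~ finite_dimensional X ->
  exists (T : {linear X -> X}) (y : nat -> X),
    [/\ forall x, rnorm (T x) <= rnorm x,
        forall k, iter k T (y k) = 0,
        forall k n, exists z, iter n T z = y k
      & forall U : set X, open U -> U !=set0 ->
          forall N, exists2 k, (N <= k)%N & U (y k)].
Proof.
move=> /separable_dense_sequence[d d_dense] infX.
have /choice[ext extP] : forall p : seq X * X, exists a,
    ~ in_span p.1 a /\ in_span (a :: p.1) p.2.
  by move=> p; apply: infinite_dimensional_extend.
pose stage := fix stage n :=
  if n is m.+1 then ext (stage m, d m) :: stage m else [::] : seq X.
pose e n := ext (stage n, d n).
pose W n : set X := in_span (stage n).
have W_sub n : is_subspace (W n) by exact: in_span_subspace.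
have W_le m n : (m <= n)%N -> W m `<=` W n.
  move=> /subnK <-; elim: (n - m)%N => // k IH x /IH.
  exact: in_span_cons.
have We n : W n.+1 (e n) by exact: in_span_head.
have Wd n : W n.+1 (d n) by case: (extP (stage n, d n)).
have WZ n a x : W n x -> W n (a *: x).
  by case: (W_sub n) => W0 Wlin Wx; rewrite -[_ *: _]addr0; apply: Wlin.
have WD n x x' : W n x -> W n x' -> W n (x + x').
  by case: (W_sub n) => W0 Wlin Wx; rewrite -[x]scale1r; apply: Wlin.
have /choice[f fP] : forall n, exists f : {scalar X},
    [/\ forall v, W n v -> f v = 0, f (e n) != 0
      & forall y, rnorm (f y) <= 2 * rnorm y].
  move=> n; have [ne _] := extP (stage n, d n).
  have [r r0 r_le] := in_span_separated ne.
  exact: separating_functional (W_sub n) r0 r_le.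
have [|c [T [c0 T1 TE]]] := @operator_of_functionals R X e (fun n => f n.+1).
  by move=> n y; case: (fP n.+1).
have TW n x : W n.+1 x -> T x = \sum_(0 <= i < n) (c i * f i.+1 x) *: e i.
  move=> Wx; apply: TE => i ni; case: (fP i.+1) => + _ _; apply.
  by apply: W_le Wx.
have W_sum n (a : nat -> R[i]) : W n (\sum_(0 <= i < n) a i *: e i).
  elim: n => [|n IH]; first by rewrite big_geq.
  rewrite big_nat_recr//=; apply: WD; last exact: WZ.
  exact: W_le (leqnSn n) _ IH.
(* As [W 0] is the zero space, the value [0.-1 = 0] is right too. *)
have T_down n x : W n x -> W n.-1 (T x).
  case: n => [->|n Wx]; first by rewrite linear0.
  by rewrite (TW n)//; apply: W_sum.
(* Triangular solution: a multiple [z1] of [e (n + 1)] gives the right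
   coefficient of [e n], and the remaining error lies in [W n]. *)
have T_up n x : W n x -> exists2 z, W n.+1 z & T z = x.
  elim: n x => [x ->|n IH x [b Wb]].
    by exists 0; [case: (W_sub 1%N)|rewrite linear0].
  have [_ fe _] := fP n.+1.
  pose z1 := (b / (c n * f n.+1 (e n.+1))) *: e n.+1.
  have Tz1 : W n (T z1 - b *: e n).
    rewrite /z1 linearZZ (TW n.+1)// big_nat_recr//= scalerDr scalerA.
    by rewrite divfK ?mulf_neq0// addrK; apply: WZ.
  have [|z2 Wz2 Tz2] := IH (x - T z1).
    have -> : x - T z1 = (x - b *: e n) + (-1) *: (T z1 - b *: e n).
      by rewrite scaleN1r opprB addrA subrK.
    by apply: WD => //; apply: WZ.
  exists (z1 + z2); last by rewrite linearD Tz2 addrC subrK.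
  apply: WD; first by apply: WZ.
  exact: W_le (leqnSn n.+1) _ Wz2.
(* Since [logn 2] takes every value infinitely often, each [d j] occurs as [y k]
   for arbitrarily large [k]; the value 0 is used until [W k] is large enough. *)
pose y k := if `[< W k (d (logn 2 k)) >] then d (logn 2 k) else 0.
have Wy k : W k (y k).
  by rewrite /y; case: asboolP => // _; case: (W_sub k).
exists T, y; split=> // [k|k n|U oU neU N].
- elim: k (y k) (Wy k) => [x ->//|k IH x Wx].
  by rewrite iterSr; apply: IH; apply: T_down Wx.
- have [z _ Tz] : exists2 z, W (k + n)%N z & iter n T z = y k.
    elim: n => [|n [z Wz Tz]]; first by exists (y k) => //; rewrite addn0.
    have [z' Wz' Tz'] := T_up _ _ Wz.
    by exists z'; rewrite ?addnS// iterSr Tz'.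
  by exists z.
- have [j Uj] := d_dense U oU neU.
  have [k Nk kj] := recurrent_enumeration j (maxn N j.+1).
  move: Nk; rewrite geq_max => /andP[Nk jk]; exists k => //.
  rewrite /y kj; case: asboolP => // -[].
  exact: W_le jk _ (Wd j).
Qed.

End Flag.

(** * Hypercyclic operators on separable spaces *)

Theorem theorem4p5 (R : realType) (Gamma : set R[i]) (F : set (set nat)) :
  ~ bounded_set (Gamma : set R[i]^o) ->
  hypercyclicity_set F ->
  forall X : completeNormedModType R[i],
    separable_space X ->
    ~ finite_dimensional X ->
    exists T : {linear X -> X},
      bounded_operator T /\ F_Gamma_hypercyclic F Gamma T.
Proof.
move=> /unbounded_rnorm unbG hF X sepX infX.
have [T [y [T1 Tker Tlift ydense]]] := operator_on_separable_space sepX infX.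
exists T; split; last exact: (hypercyclicity_criterion hF unbG T1 Tker Tlift ydense).
by exists 1 => x; rewrite mul1r -!rnormE lecR.
Qed.
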